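(* Let $a,b,c,d$ be non-zero real numbers and let $(x_n)_{n\ge -2}$, $(y_n)_{n\ge -2}$ be a well-defined real solution, with initial values $x_{-2},x_{-1},x_0,y_{-2},y_{-1},y_0$, of the system $$x_{n+1}=\frac{x_{n-2}y_{n-1}}{y_{n}(a+bx_{n-2}y_{n-1})},\qquad y_{n+1}=\frac{y_{n-2}x_{n-1}}{x_{n}(c+dy_{n-2}x_{n-1})},\qquad n\ge 0.$$ If $x_{-2}=x_0$, $y_{-2}=y_0$, $a=c$, $b=d$ and $x_{-1}y_{-2}=x_{-2}y_{-1}=\dfrac{1-a}{b}$, then the solution is periodic with period two.
   Context: A solution is well-defined if no denominator appearing in the recurrence vanishes for any $n\ge 0$. A solution is periodic with period $p$ if $x_{n+p}=x_n$ and $y_{n+p}=y_n$ for all $n\ge -2$. *)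

(* Defs.v *)
From Stdlib Require Import Reals ZArith.
Open Scope R_scope.

(* Sequences (u_n) with n >= -2 are functions Z -> R of which only the values
   at indices n >= -2 are ever mentioned. *)

Definition denom_x (a b : R) (x y : Z -> R) (n : Z) : R :=
  y n * (a + b * x (n - 2)%Z * y (n - 1)%Z).

Definition denom_y (c d : R) (x y : Z -> R) (n : Z) : R :=
  x n * (c + d * y (n - 2)%Z * x (n - 1)%Z).

Definition is_solution (a b c d : R) (x y : Z -> R) : Prop :=
  forall n : Z, (0 <= n)%Z ->
    x (n + 1)%Z = x (n - 2)%Z * y (n - 1)%Z / denom_x a b x y n /\
    y (n + 1)%Z = y (n - 2)%Z * x (n - 1)%Z / denom_y c d x y n.

(* Needed because division by 0 is total in R. *)
Definition well_defined (a b c d : R) (x y : Z -> R) : Prop :=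
  forall n : Z, (0 <= n)%Z ->
    denom_x a b x y n <> 0 /\ denom_y c d x y n <> 0.

(* p is a period, not necessarily the least one. *)
Definition periodic (p : Z) (x y : Z -> R) : Prop :=
  forall n : Z, (-2 <= n)%Z -> x (n + p)%Z = x n /\ y (n + p)%Z = y n.

(* Main.v *)
Require Import Defs.
From Stdlib Require Import Reals ZArith Lia.
Open Scope R_scope.

(** Put [K = (1 - a) / b], so that [a + b * K = 1].  While the products
    [x (n-2) * y (n-1)] and [y (n-2) * x (n-1)] both equal [K], the nonlinear
    factors of the denominators equal 1 and the recurrence reduces to
    [x (n+1) = K / y n] and [y (n+1) = K / x n].  If moreover
    [x n = x (n-2)] and [y n = y (n-2)], the two products may be read as
    [x n * y (n-1) = K] and [y n * x (n-1) = K], so that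
    [x (n+1) = x (n-1)] and [y (n+1) = y (n-1)].  These four equalities thus
    form an invariant of the recurrence ([resonant_step]), which the hypotheses
    place on the initial values; it contains 2-periodicity. *)

(** The two equations of the system are exchanged by swapping [x] and [y], so
    this computation serves for both: [p], [q], [r], [s] stand for
    [x (n-2)], [y (n-1)], [y n], [x (n-1)].  The numerator [p * q] is replaced
    by [r * s], from which the factor [r] cancels; this covers [K = 0] too. *)
Lemma resonant_quotient (a b p q r s : R) :
  b <> 0 -> p * q = (1 - a) / b -> r * s = (1 - a) / b ->
  r * (a + b * p * q) <> 0 ->
  p * q / (r * (a + b * p * q)) = s.
Proof.
  intros hb hpq hrs hden.
  assert (h1 : a + b * p * q = 1).
  { rewrite Rmult_assoc, hpq. field. exact hb. }
  rewrite h1, Rmult_1_r in *.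
  rewrite hpq, <- hrs. field. exact hden.
Qed.

Definition resonant (K : R) (x y : Z -> R) (n : Z) : Prop :=
  x n = x (n - 2)%Z /\ y n = y (n - 2)%Z /\
  x (n - 2)%Z * y (n - 1)%Z = K /\ y (n - 2)%Z * x (n - 1)%Z = K.

Lemma resonant_step (a b : R) (x y : Z -> R) (n : Z) :
  b <> 0 -> is_solution a b a b x y -> well_defined a b a b x y ->
  (0 <= n)%Z -> resonant ((1 - a) / b) x y n ->
  resonant ((1 - a) / b) x y (n + 1).
Proof.
  intros hb hsol hwd hn (ex & ey & hxy & hyx).
  destruct (hsol n hn) as [sx sy], (hwd n hn) as [dx dy].
  unfold resonant.
  replace (n + 1 - 2)%Z with (n - 1)%Z by lia.
  replace (n + 1 - 1)%Z with n by lia.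
  repeat split.
  - rewrite sx. apply resonant_quotient; trivial. now rewrite ey.
  - rewrite sy. apply resonant_quotient; trivial. now rewrite ex.
  - now rewrite Rmult_comm, ey.
  - now rewrite Rmult_comm, ex.
Qed.

Theorem theorem4p1 (a b c d : R) (x y : Z -> R)
  (ha : a <> 0) (hb : b <> 0) (hc : c <> 0) (hd : d <> 0)
  (hsol : is_solution a b c d x y)
  (hwd : well_defined a b c d x y)
  (hx : x (-2)%Z = x 0%Z) (hy : y (-2)%Z = y 0%Z)
  (hac : a = c) (hbd : b = d)
  (hxy : x (-1)%Z * y (-2)%Z = x (-2)%Z * y (-1)%Z)
  (hval : x (-2)%Z * y (-1)%Z = (1 - a) / b) :
  periodic 2 x y.
Proof.
  subst c d.
  assert (hres : forall n, (0 <= n)%Z -> resonant ((1 - a) / b) x y n).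
  { apply natlike_ind.
    - repeat split; simpl; auto. now rewrite Rmult_comm, hxy.
    - intros n hn IH. now apply resonant_step. }
  intros n hn.
  destruct (hres (n + 2)%Z ltac:(lia)) as (ex & ey & _).
  now replace (n + 2 - 2)%Z with n in ex, ey by lia.
Qed.
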